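(* Let $1\leqslant q<p<r<2$ be real numbers and let $g\colon\Omega\to\mathbb R$ be a function such that $g\in\mathbb L^q$ and $g-g\circ T\in\mathbb L^r$. If $q\geqslant (p-1)r/(r-1)$, then for any martingale differences sequence $(m\circ T^i)_{i\geqslant 0}$ with $m\in\mathbb L^p$, the function $f:=m+g-g\circ T$ satisfies the following: for every $\alpha\in[1/p,1]$ and every $\varepsilon>0$, $$\sum_{n=1}^{+\infty}n^{\alpha p-2}\,\mu\left\{\max_{1\leqslant k\leqslant n}|S_k(f)|\geqslant\varepsilon n^\alpha\right\}<+\infty.$$
   Context: $(\Omega,\mathcal F,\mu)$ is a probability space and $T\colon\Omega\to\Omega$ is a bijective, bi-measurable, measure-preserving map; the system is ergodic, i.e. $T^{-1}A=A$ with $A\in\mathcal F$ implies $\mu(A)\in\{0,1\}$. For measurable $f\colon\Omega\to\mathbb R$ and $n\geqslant 1$, $S_n(f):=\sum_{j=0}^{n-1}f\circ T^j$. $(m\circ T^i)_{i\geqslant 0}$ is a martingale differences sequence if it is one (integrable, adapted, with zero conditional expectations given the past) with respect to some filtration. *)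

(* Defs.v *)
From mathcomp Require Import all_boot all_order all_algebra.
From mathcomp Require Import all_classical all_reals all_analysis.

Set Implicit Arguments.
Unset Strict Implicit.
Unset Printing Implicit Defensive.

Import Order.TTheory GRing.Theory Num.Theory.
Import numFieldNormedType.Exports.

Local Open Scope classical_set_scope.
Local Open Scope ring_scope.

Record automorphism d (Omega : measurableType d) (R : realType)
    (mu : probability Omega R) (T : Omega -> Omega) : Prop := Automorphism {
  aut_bijective : bijective T ;
  aut_measurable : measurable_fun [set: Omega] T ;
  aut_measurable_inv : forall A : set Omega, measurable A -> measurable (T @` A) ;
  aut_preserving : forall A : set Omega, measurable A -> mu (T @^-1` A) = mu A
}.

Definition ergodic d (Omega : measurableType d) (R : realType)
    (mu : probability Omega R) (T : Omega -> Omega) : Prop :=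
  forall A : set Omega, measurable A -> T @^-1` A = A -> mu A = 0%E \/ mu A = 1%E.

Definition birkhoff_sum (Omega : Type) (R : realType) (T : Omega -> Omega)
    (f : Omega -> R) (n : nat) (w : Omega) : R :=
  \sum_(0 <= j < n) f (iter j T w).

(* The maximum is over nonnegative reals, so the unit 0 does not change it
   when n >= 1. *)
Definition max_birkhoff_sum (Omega : Type) (R : realType) (T : Omega -> Omega)
    (f : Omega -> R) (n : nat) (w : Omega) : R :=
  \big[Num.max/0]_(1 <= k < n.+1) `|birkhoff_sum T f k w|.

Definition sub_sigma_algebra_of d (Omega : measurableType d)
    (G : set (set Omega)) : Prop :=
  sigma_algebra [set: Omega] G /\ G `<=` measurable.

Definition filtration d (Omega : measurableType d)
    (F : nat -> set (set Omega)) : Prop :=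
  (forall i, sub_sigma_algebra_of (F i)) /\
  (forall i j, (i <= j)%N -> F i `<=` F j).

Definition measurable_wrt d (Omega : measurableType d) (R : realType)
    (G : set (set Omega)) (X : Omega -> R) : Prop :=
  forall B : set R, measurable B -> G (X @^-1` B).

(* Y is a version of the conditional expectation of X given G. *)
Definition is_cond_exp d (Omega : measurableType d) (R : realType)
    (mu : probability Omega R) (G : set (set Omega)) (X Y : Omega -> R) : Prop :=
  [/\ measurable_wrt G Y,
      mu.-integrable [set: Omega] (EFin \o Y) &
      forall A, G A ->
        (\int[mu]_(w in A) (Y w)%:E = \int[mu]_(w in A) (X w)%:E)%E].

(* The filtration is indexed by i >= 0, so X 0 has no past and no condition is
   put on its mean; if X is stationary, 'E[X 0] = 'E[X 1] = 0 follows. *)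
Definition martingale_differences d (Omega : measurableType d) (R : realType)
    (mu : probability Omega R) (X : nat -> Omega -> R) : Prop :=
  exists F : nat -> set (set Omega),
    [/\ filtration F,
        forall i, mu.-integrable [set: Omega] (EFin \o X i),
        forall i, measurable_wrt (F i) (X i) &
        forall i, is_cond_exp mu (F i) (X i.+1) (cst 0)].

(* Main.v *)
Require Import Defs.
From mathcomp Require Import all_boot all_order all_algebra.
From mathcomp Require Import all_classical all_reals all_analysis.
From mathcomp Require Import measurable_realfun ring lra.

(** Since S_k f = S_k m + g - g o T^k, the martingale and the coboundary are
    treated separately, at level eps/2 each.

    Martingale: let U be the partial sums of m stopped when they leave [-l, l],
    and let H be the Huber function, quadratic on [-l, l] and affine outside.
    Then H(u + x) <= H(u) + 2ux + min(x^2, 4l|x|) for |u| < l, and the linear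
    term integrates to zero against a martingale difference, so that
    l^2 mu(max_{k <= n} |S_k m| >= l) <= n E[min(m^2, 4l|m|)].
    This replaces truncation and recentring. With l = e n^alpha, summing over n
    under the integral gives a multiple of E|m|^p.

    Coboundary: with h = g - g o T and blocks of length l ~ n^(alpha (p - q)), a
    value |g o T^k| >= 2x, x ~ n^alpha, k <= n, forces |g| >= x at the start of
    a block or a sum of |h| over a block to be at least x. The n/l block starts
    contribute sum_n n^(alpha q - 1) mu(|g| >= x) <= C E|g|^q, and the sums of
    |h| contribute a multiple of E|h|^(1 + (p - 1)/(1 - p + q)), up to a constant
    at most E|h|^r; the exponent is at most r exactly when
    q >= (p - 1) r / (r - 1). *)

Import Order.TTheory GRing.Theory Num.Theory.
Import numFieldNormedType.Exports.

Local Open Scope classical_set_scope.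
Local Open Scope ring_scope.

Set Implicit Arguments.
Unset Strict Implicit.

(** * Sums of powers *)

(** The right-hand side is the tangent at 1 of the concave function [x ^ s]. With [L = ln x] it
    becomes convexity of the exponential between [0] and [L]. *)
Lemma powR_le_affine (R : realType) (s x : R) :
  0 < s <= 1 -> 0 <= x -> x `^ s <= s * x + (1 - s).
Proof.
move=> /andP[s0 s1]; rewrite le_eqVlt => /predU1P[<-|x0].
  by rewrite powR0 ?gt_eqF//; lra.
rewrite /powR gt_eqF//; set L := ln x.
have -> : x = expR L by rewrite lnK.
(* Tangent line of expR at s * L, evaluated at L and at 0. *)
set E := expR (s * L).
have hL : E * (1 + (L - s * L)) <= expR L.
  have -> : expR L = E * expR (L - s * L) by rewrite -expRD; congr expR; ring.
  by rewrite ler_pM2l ?expR_gt0// expR_ge1Dx.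
have h0 : E * (1 + (0 - s * L)) <= 1.
  have {2}-> : 1 = E * expR (0 - s * L) by rewrite -expRD addrC subrK expR0.
  by rewrite ler_pM2l ?expR_gt0// expR_ge1Dx.
have {}hL := ler_wpM2l (ltW s0) hL.
have s1' : 0 <= 1 - s by lra.
have {}h0 := ler_wpM2l s1' h0.
have := lerD hL h0; rewrite mulr1; apply: le_trans.
rewrite le_eqVlt; apply/orP; left; apply/eqP; ring.
Qed.

(** For a concave power the increment dominates the derivative at the right endpoint. It is the
    affine bound at the ratio [n / (n + 1)], rescaled, which also covers [n = 0]. *)
Lemma powR_increment_ge (R : realType) (s : R) (n : nat) : 0 < s <= 1 ->
  s * n.+1%:R `^ (s - 1) <= n.+1%:R `^ s - n%:R `^ s.
Proof.
move=> hs; have N0 : 0 < n.+1%:R :> R by rewrite ltr0n.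
have := @powR_le_affine R s (n%:R / n.+1%:R) hs (divr_ge0 (ler0n _ _) (ler0n _ _)).
move=> /(ler_wpM2l (powR_ge0 n.+1%:R s)).
rewrite -powRM ?divr_ge0 ?ler0n// mulrC divfK ?gt_eqF//.
rewrite powRB ?(gt_eqF N0) ?implybT// powRr1 ?(ltW N0)//.
have -> : n%:R = n.+1%:R - 1 :> R by rewrite -natr1 addrK.
set N := n.+1%:R in N0 *; set P := N `^ s.
have -> : P * (s * ((N - 1) / N) + (1 - s)) = P - s * (P / N).
  by field; rewrite gt_eqF.
by move=> h; rewrite lerBrDr -lerBrDl.
Qed.

(** The analogue for a decreasing convex power, obtained from [1 + u <= expR u] and [ln x <= x - 1]
    at the ratio [n / (n + 1)]. *)
Lemma powRN_decrement_ge (R : realType) (s : R) (n : nat) : 0 < s -> (0 < n)%N ->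
  s * n.+1%:R `^ (- s - 1) <= n%:R `^ (- s) - n.+1%:R `^ (- s).
Proof.
move=> s0 n0; have N0 : 0 < n.+1%:R :> R by rewrite ltr0n.
have n0' : 0 < n%:R :> R by rewrite ltr0n.
rewrite powRB ?(gt_eqF N0) ?implybT// powRr1 ?(ltW N0)//.
have -> : n%:R `^ (- s) = n.+1%:R `^ (- s) * (n%:R / n.+1%:R) `^ (- s) :> R.
  by rewrite -powRM ?divr_ge0 ?ltW// mulrC divfK ?gt_eqF.
have x0 : 0 < n%:R / n.+1%:R :> R by exact: divr_gt0.
have : 1 + s / n.+1%:R <= (n%:R / n.+1%:R) `^ (- s) :> R.
  rewrite /powR gt_eqF//; apply: le_trans (expR_ge1Dx _).
  rewrite lerD2l mulNr -mulrN ler_pM2l// lerNr.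
  have h : ln (n%:R / n.+1%:R) <= n%:R / n.+1%:R - 1 :> R.
    by rewrite -{1}[n%:R / _](subrK 1) addrC le_ln1Dx// ltrBrDr addNr.
  apply: (le_trans h).
  have -> : n%:R = n.+1%:R - 1 :> R by rewrite -natr1 addrK.
  rewrite le_eqVlt; apply/orP; left; apply/eqP; field.
  by rewrite gt_eqF.
move=> /(ler_wpM2l (powR_ge0 n.+1%:R (- s))).
by rewrite mulrDr mulr1 mulrCA -lerBrDl.
Qed.

Lemma sum_powR_le (R : realType) (s Y : R) (M : nat) : 0 < s <= 1 -> 0 <= Y ->
  \sum_(1 <= n < M.+1 | n%:R <= Y) n%:R `^ (s - 1) <= Y `^ s / s.
Proof.
move=> /[dup] hs /andP[s0 s1] Y0.
(* The minimum makes the induction close: up to [Y] the increments telescope, and beyond [Y] neither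
   the sum nor the need for a larger bound grows. *)
suff: \sum_(1 <= n < M.+1 | n%:R <= Y) n%:R `^ (s - 1)
      <= (Num.min M%:R Y) `^ s / s.
  move=> /le_trans; apply; rewrite ler_pM2r ?invr_gt0//.
  rewrite ge0_ler_powR ?nnegrE ?(ltW s0)// ?le_min ?Y0 ?ler0n//.
  by rewrite ge_min lexx orbT.
elim: M => [|M IH]; first by rewrite big_nil divr_ge0 ?powR_ge0 ?ltW.
rewrite big_mkcond/= big_nat_recr//= -big_mkcond/=; case: ifPn => hM.
  rewrite (min_idPl hM); move: IH; rewrite (min_idPl _); last first.
    by apply: le_trans hM; rewrite ler_nat.
  have := powR_increment_ge M hs; rewrite -ler_pdivlMl// => h1 h2.
  by apply: (le_trans (lerD h2 h1)); rewrite [_ / s]mulrC -mulrDr addrC subrK mulrC.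
rewrite addr0; apply: (le_trans IH); rewrite ler_pM2r ?invr_gt0//.
rewrite ge0_ler_powR ?nnegrE ?(ltW s0)// ?le_min ?Y0 ?ler0n//.
by rewrite !ge_min lexx orbT ler_nat leqnSn.
Qed.

Lemma sum_powRN_le (R : realType) (s Y : R) (M : nat) : 0 < s -> 0 < Y ->
  \sum_(1 <= n < M.+1 | Y < n%:R) n%:R `^ (- s - 1) <= (1 + s^-1) * Y `^ (- s).
Proof.
move=> s0 Y0.
have YN k : Y < k%:R -> k%:R `^ (- s) <= Y `^ (- s).
  move=> Yk; have k0 := lt_trans Y0 Yk.
  rewrite !powRN lef_pV2 ?posrE ?powR_gt0//.
  by rewrite ge0_ler_powR ?nnegrE ?(ltW s0) ?(ltW Y0) ?(ltW k0) ?(ltW Yk).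
(* Telescoping, with the first index above Y accounting for the summand 1. *)
suff: \sum_(1 <= n < M.+1 | Y < n%:R) n%:R `^ (- s - 1)
      <= if M%:R <= Y then 0 else (1 + s^-1) * Y `^ (- s) - s^-1 * M%:R `^ (- s).
  move=> /le_trans; apply; case: ifPn => _.
    by rewrite mulr_ge0 ?powR_ge0 ?addr_ge0 ?invr_ge0 ?ltW.
  by rewrite gerBl mulr_ge0 ?powR_ge0// invr_ge0 (ltW s0).
elim: M => [|M IH]; first by rewrite big_nil (ltW Y0).
rewrite big_mkcond/= big_nat_recr//= -big_mkcond/= ltNge.
case: (leP M.+1%:R Y) => hM /=.
  move: IH; rewrite addr0 (_ : M%:R <= Y)//.
  by apply: le_trans hM; rewrite ler_nat.
move: IH; case: (leP M%:R Y) => [MY|YM] IH.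
  apply: (le_trans (lerD IH (lexx _))); rewrite add0r.
  have h1 := YN _ hM.
  have : s^-1 * M.+1%:R `^ (- s) <= s^-1 * Y `^ (- s).
    by rewrite ler_pM2l ?invr_gt0.
  have : M.+1%:R `^ (- s - 1) <= M.+1%:R `^ (- s).
    by apply: ler_powR; [rewrite ler1n|lra].
  lra.
apply: (le_trans (lerD IH (lexx _))).
have M0 : (0 < M)%N by rewrite -(ltr0n R) (lt_trans Y0).
have := powRN_decrement_ge s0 M0; rewrite -ler_pdivlMl//; lra.
Qed.

Lemma powR_le_root (R : realType) (a x y : R) : 0 < a -> 0 <= x -> 0 <= y ->
  (x `^ a <= y) = (x <= y `^ a^-1).
Proof.
move=> a0 x0 y0; have a'0 : 0 <= a^-1 by rewrite invr_ge0 ltW.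
apply/idP/idP => [/(ge0_ler_powR a'0)|/(ge0_ler_powR (ltW a0))].
  by rewrite -powRrM divff ?gt_eqF// powRr1//; apply; rewrite nnegrE ?powR_ge0.
rewrite -powRrM mulVf ?gt_eqF// powRr1//; apply; rewrite nnegrE//.
exact: powR_ge0.
Qed.

(** The cut is at [n = y ^ (1 / a)]. Below it the linear branch leaves the exponent [a (p - 1) - 1],
    above it the square leaves [- a (2 - p) - 1], whose tail converges because [p < 2]; both parts
    scale as [y ^ p]. *)
Lemma sum_min_sqr_le (R : realType) (a p K y : R) (M : nat) :
  0 < a <= 1 -> 1 < p < 2 -> 0 <= K -> 0 <= y ->
  \sum_(1 <= n < M.+1)
    n%:R `^ (a * p - 1 - 2 * a) * Num.min (y ^+ 2) (K * n%:R `^ a * y)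
  <= (K / (a * (p - 1)) + (1 + (a * (2 - p))^-1)) * y `^ p.
Proof.
move=> /andP[a0 a1] /andP[p1 p2] K0; rewrite le_eqVlt => /predU1P[<-|y0].
  rewrite powR0 ?mulr0; last by rewrite gt_eqF// (lt_trans _ p1).
  by rewrite big1// => n _; rewrite expr0n/= mulr0 minxx mulr0.
set Y := y `^ a^-1; have Y0 : 0 < Y by exact: powR_gt0.
have s0 : 0 < a * (p - 1) by rewrite mulr_gt0// subr_gt0.
have s1 : a * (p - 1) <= 1 by rewrite mulr_ile1//; lra.
have s'0 : 0 < a * (2 - p) by rewrite mulr_gt0// subr_gt0.
have Ypow b : Y `^ (a * b) = y `^ b by rewrite -powRrM mulKf ?gt_eqF.
rewrite (bigID (fun n => n%:R <= Y))/= [leRHS]mulrDl; apply: lerD.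
  apply: (@le_trans _ _ (\sum_(1 <= n < M.+1 | n%:R <= Y)
      n%:R `^ (a * (p - 1) - 1) * (K * y))).
    rewrite [leLHS]big_nat_cond [leRHS]big_nat_cond; apply: ler_sum => n /andP[/andP[n1 _] _].
    have n0 : 0 < n%:R :> R by rewrite ltr0n.
    have -> : a * (p - 1) - 1 = (a * p - 1 - 2 * a) + a by ring.
    rewrite (@powRD _ n%:R (a * p - 1 - 2 * a)) ?(gt_eqF n0) ?implybT//.
    rewrite -[leRHS]mulrA ler_wpM2l ?powR_ge0//.
    by rewrite ge_min orbC mulrCA mulrA lexx.
  rewrite -mulr_suml.
  have -> : K / (a * (p - 1)) * y `^ p = y `^ (p - 1) / (a * (p - 1)) * (K * y).
    by rewrite -(@mulr_powRB1 _ y p) ?(ltW y0)//; [ring|lra].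
  rewrite ler_wpM2r ?mulr_ge0 ?(ltW y0)// -Ypow.
  by rewrite sum_powR_le ?s0 ?(ltW Y0).
apply: (@le_trans _ _ (\sum_(1 <= n < M.+1 | Y < n%:R)
    n%:R `^ (- (a * (2 - p)) - 1) * y ^+ 2)).
  under eq_bigl do rewrite -ltNge.
  apply: ler_sum => n _.
  have -> : - (a * (2 - p)) - 1 = a * p - 1 - 2 * a by ring.
  by rewrite ler_wpM2l ?powR_ge0// ge_min lexx.
rewrite -mulr_suml.
have -> : y `^ p = y `^ (- (2 - p)) * y ^+ 2.
  rewrite -powR_mulrn ?(ltW y0)// -powRD ?(gt_eqF y0) ?implybT//; congr (_ `^ _).
  ring.
by rewrite mulrA ler_wpM2r ?sqr_ge0// -Ypow mulrN sum_powRN_le.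
Qed.

(** Since [a * q] may exceed 1, the factor [(n ^ a) ^ (q - 1)] is first bounded by [y ^ (q - 1)];
    the exponent [a - 1] that remains is within reach of [sum_powR_le]. *)
Lemma sum_powR_level_le (R : realType) (a q y : R) (M : nat) :
  0 < a <= 1 -> 1 <= q -> 0 <= y ->
  \sum_(1 <= n < M.+1 | n%:R `^ a <= y) n%:R `^ (a * q - 1) <= y `^ q / a.
Proof.
move=> /[dup] ha /andP[a0 a1] q1 y0.
apply: (@le_trans _ _ (\sum_(1 <= n < M.+1 | n%:R <= y `^ a^-1)
    n%:R `^ (a - 1) * y `^ (q - 1))).
  under [leRHS]eq_bigl do rewrite -powR_le_root//.
  rewrite [leLHS]big_nat_cond [leRHS]big_nat_cond.
  apply: ler_sum => n /andP[/andP[n1 _] ny].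
  have n0 : 0 < n%:R :> R by rewrite ltr0n.
  have -> : a * q - 1 = (a - 1) + a * (q - 1) by ring.
  rewrite powRD ?(gt_eqF n0) ?implybT// ler_wpM2l ?powR_ge0// powRrM.
  by rewrite ge0_ler_powR ?nnegrE ?powR_ge0// subr_ge0.
rewrite -mulr_suml -(@mulr_powRB1 _ y q) ?(lt_le_trans _ q1)// mulrAC.
rewrite ler_wpM2r ?powR_ge0//.
apply: (le_trans (sum_powR_le _ ha (powR_ge0 _ _))).
by rewrite -powRrM mulVf ?gt_eqF// powRr1.
Qed.

(** Only indices with [n ^ c <= z] contribute, each at most [n ^ (s - 1) * z], so the total is at
    most [z ^ (1 + s / c) / s]. The exponent is at most [r]; the summand 1 covers [z < 1]. *)
Lemma sum_excess_le (R : realType) (s c r z : R) (M : nat) :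
  0 < s <= 1 -> 0 < c -> s / c <= r - 1 -> 0 <= z ->
  \sum_(1 <= n < M.+1) n%:R `^ (s - 1) * Num.max 0 (z - n%:R `^ c)
  <= (1 + z `^ r) / s.
Proof.
move=> /[dup] hs /andP[s0 s1] c0 src z0.
apply: (@le_trans _ _ (\sum_(1 <= n < M.+1 | n%:R <= z `^ c^-1)
    n%:R `^ (s - 1) * z)).
  rewrite [leRHS]big_mkcond; apply: ler_sum => n _.
  rewrite -powR_le_root//; case: ifPn => nz.
    by rewrite ler_wpM2l ?powR_ge0// ge_max z0 gerBl powR_ge0.
  by rewrite max_l ?mulr0// subr_le0 ltW// ltNge.
rewrite -mulr_suml; apply: (@le_trans _ _ ((z `^ c^-1) `^ s / s * z)).
  by rewrite ler_wpM2r// sum_powR_le ?powR_ge0.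
rewrite -powRrM mulrAC ler_pM2r ?invr_gt0// (mulrC c^-1) (mulrC _ z).
have sc0 : 0 < s / c by exact: divr_gt0.
have -> : s / c = (s / c + 1) - 1 by ring.
rewrite mulr_powRB1 ?addr_gt0//.
have [z1|z1] := leP 1 z.
  apply: (@le_trans _ _ (z `^ r)); last by rewrite lerDr.
  by apply: ler_powR => //; rewrite -lerBrDr.
apply: (@le_trans _ _ 1); last by rewrite lerDl powR_ge0.
have := @ge0_ler_powR _ (s / c + 1) _ z 1; rewrite powR1.
by apply; rewrite ?nnegrE ?(ltW z1)// addr_ge0// ltW.
Qed.

(** * Integrals *)

(** Partial sums are taken under the integral, where the pointwise bound by [G] is uniform in their
    length. Both series of the proof are summed this way. *)
Lemma nneseries_lty_dominated d (T : measurableType d) (R : realType)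
    (mu : {measure set T -> \bar R}) (u : nat -> \bar R) (F : nat -> T -> R)
    (G : T -> R) :
  (forall n, (0 <= u n)%E) ->
  (forall n, measurable_fun setT (F n)) -> (forall n w, 0 <= F n w) ->
  (forall n, (0 < n)%N -> (u n <= \int[mu]_w (F n w)%:E)%E) ->
  mu.-integrable setT (EFin \o G) ->
  (forall M w, \sum_(1 <= n < M.+1) F n w <= G w) ->
  (\sum_(1 <= n <oo) u n < +oo)%E.
Proof.
move=> u0 mF F0 uF iG FG.
have mG : measurable_fun setT G by apply/measurable_EFinP; case/integrableP: iG.
apply: le_lt_trans (integrable_lty measurableT iG).
apply: lime_le; first by apply: is_cvg_nneseries => n _ _; exact: u0.
apply: nearW => -[|M].
  rewrite big_geq//; apply: integral_ge0 => w _.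
  (* The bound [FG] at length 0 compares an empty sum with [G], hence [G] is nonnegative. *)
  by rewrite lee_fin (le_trans _ (FG 0 w)) ?big_nil.
apply: (@le_trans _ _ (\sum_(1 <= n < M.+1) \int[mu]_w (F n w)%:E)%E).
  rewrite big_nat_cond [leRHS]big_nat_cond.
  by apply: lee_sum => n /andP[/andP[n1 _] _]; exact: uF.
rewrite -ge0_integral_sum//; last 2 first.
  - by move=> n; exact/measurable_EFinP.
  - by move=> n w _; rewrite lee_fin.
apply: ge0_le_integral => //.
- by move=> w _; apply: sume_ge0 => n _; rewrite lee_fin.
- by apply: emeasurable_sum => n; exact/measurable_EFinP.
- exact/measurable_EFinP.
- by move=> w _; rewrite sumEFin lee_fin.
Qed.

Lemma Lfun_powR_integrable d (T : measurableType d) (R : realType)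
    (mu : {measure set T -> \bar R}) (f : T -> R) (p : R) :
  0 < p -> f \in Lfun mu p%:E ->
  measurable_fun setT f /\ mu.-integrable setT (EFin \o (fun w => `|f w| `^ p)).
Proof.
move=> p0 /andP[/[!inE] mf fp]; split; first exact: mf.
apply/integrableP; split.
  apply/measurable_EFinP; apply: (measurableT_comp (measurable_powR p)).
  exact: measurableT_comp.
under eq_integral do rewrite /= ger0_norm ?powR_ge0//.
have -> : (\int[mu]_w (`|f w| `^ p)%:E = 'N[mu]_p%:E[EFin \o f] `^ p)%E.
  by rewrite poweR_Lnorm ?gt_eqF.
by apply: poweR_lty; exact: fp.
Qed.

Lemma markov_ge0 d (T : measurableType d) (R : realType)
    (mu : {measure set T -> \bar R}) (f : T -> R) (a : R) :
  measurable_fun setT f -> (forall w, 0 <= f w) -> 0 < a ->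
  (a%:E * mu [set w | (a <= f w)%R] <= \int[mu]_w (f w)%:E)%E.
Proof.
move=> mf f0 a0.
have mE : measurable [set w | a <= f w].
  rewrite -[X in measurable X]setTI; exact: measurable_fun_le.
rewrite -integral_cst//; apply: (@le_trans _ _ (\int[mu]_(w in [set w | (a <= f w)%R]) (f w)%:E)%E).
  apply: ge0_le_integral => //.
  - by move=> w _; rewrite lee_fin ltW.
  - by apply/measurable_EFinP; exact: measurable_funTS.
apply: ge0_subset_integral => //.
- exact/measurable_EFinP.
- by move=> w _; rewrite lee_fin.
Qed.

(** * Iterates of a measure-preserving map *)

Section measure_preserving_iterates.
Context d (T : measurableType d) (R : realType) (mu : {measure set T -> \bar R}).
Variable phi : T -> T.
Hypothesis mphi : measurable_fun setT phi.
Hypothesis phi_mu : forall A, measurable A -> mu (phi @^-1` A) = mu A.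

Lemma measurable_iter j : measurable_fun setT (iter j phi).
Proof.
elim: j => [|j IH]; first exact: measurable_id.
exact: (measurableT_comp mphi IH).
Qed.

Lemma measurable_comp_iter j (f : T -> R) :
  measurable_fun setT f -> measurable_fun setT (fun w => f (iter j phi w)).
Proof. by move=> mf; exact: (measurableT_comp mf (measurable_iter j)). Qed.

Lemma measure_preimage_iter j (A : set T) :
  measurable A -> mu (iter j phi @^-1` A) = mu A.
Proof.
move=> mA; elim: j => [//|j IH]; rewrite -IH -[RHS]phi_mu//.
  by congr (mu _); apply/seteqP; split => w/=; rewrite -iterSr.
by rewrite -[X in measurable X]setTI; exact: measurable_iter.
Qed.

Lemma ge0_integral_comp_iter j (f : T -> R) :
  measurable_fun setT f -> (forall w, 0 <= f w) ->
  (\int[mu]_w (f (iter j phi w))%:E = \int[mu]_w (f w)%:E)%E.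
Proof.
move=> mf f0.
have := @ge0_integral_pushforward _ _ _ _ R _ (measurable_iter j) mu setT (EFin \o f).
rewrite preimage_setT => <-//; last 2 first.
- exact/measurable_EFinP.
- by move=> w _; rewrite lee_fin.
apply: eq_measure_integral => [|? A mA _]; first exact: measurable_iter.
exact: measure_preimage_iter.
Qed.

End measure_preserving_iterates.

(** * Maximal inequality for martingale differences *)

(** Turns measurability for a sub-sigma-algebra into ordinary measurability on the generated
    measurable type, so that the closure rules for measurable functions apply to adapted
    processes. *)
Lemma measurable_wrtP d (T : measurableType d) (R : realType)
    (G : set (set T)) (X : T -> R) : sigma_algebra setT G ->
  measurable_wrt G X <->
  measurable_fun [set: g_sigma_algebraType G] (X : g_sigma_algebraType G -> R).
Proof.
move=> sG; have GE := measurable_g_measurableTypeE sG.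
split=> [mX _ B mB|mX B mB].
  by rewrite setTI GE; exact: mX.
by have := mX measurableT B mB; rewrite setTI GE.
Qed.

Lemma measurable_wrt_measurable d (T : measurableType d) (R : realType)
    (G : set (set T)) (X : T -> R) : sub_sigma_algebra_of G ->
  measurable_wrt G X -> measurable_fun setT X.
Proof. by move=> [_ GT] mX _ B mB; rewrite setTI; exact/GT/mX. Qed.

Lemma measurable_wrt_comp d (T : measurableType d) (R : realType)
    (G : set (set T)) (X : T -> R) (h : R -> R) : measurable_fun setT h ->
  measurable_wrt G X -> measurable_wrt G (h \o X).
Proof.
move=> mh mX B mB; rewrite comp_preimage; apply: mX.
by rewrite -[X in measurable X]setTI; exact: mh.
Qed.

Lemma integrable_le_norm d (T : measurableType d) (R : realType)
    (mu : {measure set T -> \bar R}) (f g : T -> R) :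
  measurable_fun setT f -> (forall w, `|f w| <= `|g w|) ->
  mu.-integrable setT (EFin \o g) -> mu.-integrable setT (EFin \o f).
Proof.
move=> mf fg; apply: le_integrable => //; first exact/measurable_EFinP.
by move=> w _; rewrite lee_fin.
Qed.

Lemma integrable_scale d (T : measurableType d) (R : realType)
    (mu : {measure set T -> \bar R}) (c : R) (f : T -> R) :
  mu.-integrable setT (EFin \o f) ->
  mu.-integrable setT (EFin \o (fun w => c * f w)).
Proof. by move=> fi; exact: (integrableZl measurableT c fi). Qed.

Lemma integrable_add d (T : measurableType d) (R : realType)
    (mu : {measure set T -> \bar R}) (f g : T -> R) :
  mu.-integrable setT (EFin \o f) -> mu.-integrable setT (EFin \o g) ->
  mu.-integrable setT (EFin \o (fun w => f w + g w)).
Proof. by move=> fi gi; exact: (integrableD measurableT fi gi). Qed.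

Lemma integrable_boundedM d (T : measurableType d) (R : realType)
    (mu : {measure set T -> \bar R}) (Z X : T -> R) (c : R) :
  measurable_fun setT Z -> (forall w, `|Z w| <= c) ->
  mu.-integrable setT (EFin \o X) ->
  mu.-integrable setT (EFin \o (fun w => Z w * X w)).
Proof.
move=> mZ Zc iX; have mX : measurable_fun setT X.
  by apply/measurable_EFinP; case/integrableP: iX.
apply: (@integrable_le_norm _ _ _ _ _ (fun w => c * X w)).
- exact: measurable_funM.
- by move=> w; rewrite !normrM ler_wpM2r// (le_trans (Zc w)) ?ler_norm.
- exact: integrable_scale.
Qed.

(** A bounded [G]-measurable factor is taken out of a vanishing conditional expectation without
    simple functions: repeated halving of its bound gives [c * K / 2 ^ n] for every [n], where [K]
    is the integral of [|X|]. *)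
Lemma Rintegral_boundedM_eq0 d (T : measurableType d) (R : realType)
    (mu : {measure set T -> \bar R}) (G : set (set T)) (X Z : T -> R) (c : R) :
  sub_sigma_algebra_of G -> mu.-integrable setT (EFin \o X) ->
  (forall A, G A -> \int[mu]_(w in A) X w = 0) ->
  measurable_wrt G Z -> (forall w, `|Z w| <= c) ->
  \int[mu]_w (Z w * X w) = 0.
Proof.
move=> sG iX X0 mZ Zc.
pose K := \int[mu]_w `|X w|.
have K0 : 0 <= K by apply: Rintegral_ge0.
have GT : G setT by rewrite -(setC0) -setTD; case: sG => -[? GC _] _; exact: GC.
(* Subtracting c/2 times the sign of Z halves the bound on Z and leaves the
   integral unchanged. *)
have halving n : forall (Z' : T -> R) (b : R), measurable_wrt G Z' ->
    (forall w, `|Z' w| <= b) -> `|\int[mu]_w (Z' w * X w)| <= b / 2 ^+ n * K.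
  elim: n => [|n IH] Z' b mZ' Zb.
    have mZ'T := measurable_wrt_measurable sG mZ'.
    have iZX := integrable_boundedM mZ'T Zb iX.
    apply: (le_trans (le_normr_Rintegral measurableT iZX)).
    rewrite expr0 divr1 -RintegralZl//; last exact: (integrable_norm iX).
    apply: le_Rintegral => //.
    - exact: (integrable_norm iZX).
    - apply: integrable_scale; exact: (integrable_norm iX).
    - by move=> w _; rewrite normrM ler_wpM2r.
  pose h (x : R) : R := if 0 <= x then x - b / 2 else x + b / 2.
  have mh : measurable_fun setT h.
    apply: measurable_fun_ifT; first exact: measurable_fun_ler.
      by apply: measurable_funB => //; exact: measurable_id.
    by apply: measurable_funD => //; exact: measurable_id.
  pose D := Z' @^-1` `[0, +oo[.
  have GD : G D by apply: mZ'.
  have mD : measurable D by case: sG => _; apply.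
  (* The sign of [Z'] is [2 * \1_D - 1], so [b / 2] times it integrates against [X] to a combination
     of integrals over [D] and over the whole space, both in [G]. *)
  have Z'E w : Z' w = (h (Z' w) + b * \1_D w) - b / 2.
    have -> : \1_D w = (0 <= Z' w)%R%:R :> R.
      by rewrite indicE; congr (nat_of_bool _)%:R; apply/idP/idP; rewrite inE /D/= in_itv/= andbT.
    by rewrite /h; case: ifP => _; rewrite ?mulr1 ?mulr0; field.
  have hb w : `|(h \o Z') w| <= b / 2.
    have := Zb w; rewrite /= /h !ler_norml; case: (leP 0 (Z' w)) => Z0 /andP[h1 h2]; lra.
  have mhZ : measurable_wrt G (h \o Z') by exact: measurable_wrt_comp.
  have ihX := integrable_boundedM (measurable_wrt_measurable sG mhZ) hb iX.
  have i1X : mu.-integrable setT (EFin \o (fun w => \1_D w * X w)).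
    apply: (integrable_boundedM (c := 1)) => //.
    by move=> w; rewrite indicE; case: (_ \in _); rewrite ?normr1 ?normr0.
  have -> : \int[mu]_w (Z' w * X w) = \int[mu]_w ((h \o Z') w * X w).
    have -> : (fun w => Z' w * X w) =
        (fun w => ((h \o Z') w * X w + b * (\1_D w * X w)) - b / 2 * X w).
      by apply/funext => w; rewrite {1}Z'E /=; ring.
    rewrite RintegralB//; last 2 first.
    - by apply: integrable_add => //; exact: integrable_scale.
    - exact: integrable_scale.
    rewrite RintegralD//; last exact: integrable_scale.
    rewrite !RintegralZl// X0// mulr0 subr0.
    have -> : \int[mu]_w (\1_D w * X w) = \int[mu]_(w in D) X w.
      rewrite [RHS]Rintegral_mkcond; apply: eq_Rintegral => w _.
      by rewrite patchE indicE; case: (_ \in _); rewrite ?mul1r ?mul0r.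
    by rewrite X0// mulr0 addr0.
  apply: (le_trans (IH _ _ mhZ hb)).
  by rewrite exprS invfM mulrA.
apply/eqP; rewrite -normr_eq0; apply/eqP/le_anti; rewrite normr_ge0 andbT.
have c0 : 0 <= c by apply: le_trans (Zc point).
apply/ler_addgt0Pl => e e0; rewrite addr0.
have [n hn] : exists n : nat, c * K / e < n%:R.
  by exists (Num.truncn (c * K / e)).+1; exact: truncnS_gt.
apply: (le_trans (halving n _ _ mZ Zc)).
rewrite mulrAC ler_pdivrMr ?exprn_gt0// -ler_pdivrMl// mulrC (le_trans (ltW hn))//.
by rewrite -natrX ler_nat ltnW// ltn_expl.
Qed.

(** Twice the usual Huber loss; the branches agree at [|s| = l] together with their slopes. *)
Definition huber (R : realType) (l s : R) : R :=
  if `|s| <= l then s ^+ 2 else 2 * l * `|s| - l ^+ 2.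

Definition clipped_sqr (R : realType) (l x : R) : R :=
  Num.min (x ^+ 2) (4 * l * `|x|).

(** The recursion takes the place of a stopping time: whether [X k] is added depends only on the sum
    before it, hence on the past. The step that leaves the interval is kept in full. *)
Fixpoint stopped_sum (T : Type) (R : realType) (X : nat -> T -> R) (l : R)
    (n : nat) (w : T) : R :=
  if n isn't k.+1 then 0 else
  let u := stopped_sum X l k w in if `|u| < l then u + X k w else u.

Section huber_theory.
Context (R : realType).
Implicit Types l s u x : R.

Lemma huber_ge0 l s : 0 <= l -> 0 <= huber l s.
Proof.
move=> l0; rewrite /huber; case: (leP `|s| l) => [_|ls]; first exact: sqr_ge0.
by have := normr_ge0 s; nra.
Qed.

Lemma huber_le_norm l s : 0 <= l -> huber l s <= 2 * l * `|s|.
Proof.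
move=> l0; rewrite /huber -(real_normK (num_real s)); have := normr_ge0 s.
by case: (leP `|s| l) => *; nra.
Qed.

Lemma huber_ge_sqr l s : 0 <= l -> l <= `|s| -> l ^+ 2 <= huber l s.
Proof.
move=> l0 ls; rewrite /huber -(real_normK (num_real s)).
by case: (leP `|s| l) => *; nra.
Qed.

(** The square branch holds because [huber] lies below the square. For the other, growth from [u]
    costs at most [2 * l * |x|], and dropping the linear term costs as much again. *)
Lemma huberD_le l u x : `|u| < l ->
  huber l (u + x) <= huber l u + 2 * u * x + clipped_sqr l x.
Proof.
move=> ul; have l0 : 0 < l by apply: le_lt_trans ul.
rewrite {2}/huber (ltW ul) /clipped_sqr -lerBlDl le_min; apply/andP; split.
  rewrite lerBlDl (_ : _ + x ^+ 2 = (u + x) ^+ 2); last by ring.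
  rewrite /huber; case: (leP `|u + x| l) => // h.
  by rewrite -(real_normK (num_real (u + x))); nra.
have [h1 h2] : u < l /\ - l < u by move: ul; rewrite ltr_norml => /andP[].
have h3 := ler_norm x; have h4 := ler_norm (- x); rewrite normrN in h4.
have h5 : - (2 * l * `|x|) <= 2 * u * x.
  have := ler_norm (- (u * x)); rewrite normrN normrM.
  have : `|u| * `|x| <= l * `|x| by rewrite ler_wpM2r// ltW.
  nra.
have h6 : huber l (u + x) <= u ^+ 2 + 2 * l * `|x|.
  have tri := ler_normD u x; have u0 := normr_ge0 u; have x0 := normr_ge0 x.
  rewrite -(real_normK (num_real u)) /huber.
  rewrite -(real_normK (num_real (u + x))).
  by have ux0 := normr_ge0 (u + x); case: (leP `|u + x| l) => h; nra.
lra.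
Qed.

End huber_theory.

(** A path ending inside the interval was never stopped. The contrapositive places the maximal event
    inside the event that the stopped sum ends at distance at least [l] from 0. *)
Lemma stopped_sum_lt (T : Type) (R : realType) (X : nat -> T -> R) (l : R)
    (n : nat) (w : T) : `|stopped_sum X l n w| < l ->
  stopped_sum X l n w = \sum_(0 <= j < n) X j w /\
  forall k, (k <= n)%N -> `|\sum_(0 <= j < k) X j w| < l.
Proof.
elim: n => [|n IH] /= h.
  by rewrite big_nil; split => // k; rewrite leqn0 => /eqP->; rewrite big_nil.
case: ifPn h => [ul hl|/negbTE ul]; last by rewrite ul.
have [E hk] := IH ul; rewrite big_nat_recr//= -E; split=> // k.
by rewrite leq_eqVlt => /predU1P[->|/hk//]; rewrite big_nat_recr//= -E.
Qed.

(** Positivity of [a] excludes the unit 0 of the maximum, so the level is attained at an index. *)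
Lemma bigmax_nat_ge (R : realType) (F : nat -> R) (a : R) (n : nat) :
  0 < a -> a <= \big[Num.max/0]_(1 <= k < n.+1) F k ->
  exists2 k, (k <= n)%N & a <= F k.
Proof.
move=> a0; apply: contraPP => Fa; apply/negP; rewrite -ltNge big_nat_cond.
apply: bigmax_lt => // k /andP[/andP[_ kn] _]; rewrite ltNge.
by apply/negP => aF; apply: Fa; exists k.
Qed.

Lemma measurable_bigmax d (T : measurableType d) (R : realType) (I : Type)
    (s : seq I) (F : I -> T -> R) : (forall i, measurable_fun setT (F i)) ->
  measurable_fun setT (fun w => \big[Num.max/0]_(i <- s) F i w).
Proof.
move=> mF; elim: s => [|i s IH].
  by under eq_fun do rewrite big_nil; exact: measurable_cst.
by under eq_fun do rewrite big_cons; exact: measurable_maxr.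
Qed.

Section martingale_maximal.
Context d (T : measurableType d) (R : realType) (mu : probability T R).
Variables (X : nat -> T -> R) (l : R).
Hypotheses (X_mds : martingale_differences mu X) (l_gt0 : 0 < l).

Let U := stopped_sum X l.

Lemma measurable_huber : measurable_fun setT (huber l).
Proof.
apply: measurable_fun_ifT.
- by apply: measurable_fun_ler => //; exact: measurable_normr.
- exact: measurable_funX.
- by apply: measurable_funB => //; apply: measurable_funM => //; exact: measurable_normr.
Qed.

Lemma measurable_clipped_sqr : measurable_fun setT (clipped_sqr l).
Proof.
apply: measurable_minr; first exact: measurable_funX.
by apply: measurable_funM => //; exact: measurable_normr.
Qed.

Lemma clipped_sqr_ge0 x : 0 <= clipped_sqr l x.
Proof. by rewrite le_min sqr_ge0/= mulr_ge0// mulr_ge0// ltW. Qed.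

(** Each step adds at most the integral of one [clipped_sqr]: [huberD_le] is integrated on the paths
    still running, and its linear term has integral zero. *)
Lemma huber_stopped_sum_le n :
  measurable_fun setT (U n) /\
  (\int[mu]_w (huber l (U n w))%:E <=
    \sum_(0 <= k < n) \int[mu]_w (clipped_sqr l (X k w))%:E)%E.
Proof.
have [F [[sF nF] iX FX X0]] := X_mds.
have mXT k : measurable_fun setT (X k) by exact: measurable_wrt_measurable (FX k).
(* The shift in index: [U k.+1] involves [X 0] to [X k], so it belongs to time [k]. *)
have mU k : measurable_wrt (F k) (U k.+1).
  elim: k => [|k IH]; apply/(measurable_wrtP _ (sF _).1).
    have /(measurable_wrtP _ (sF _).1) mX0 := FX 0%N.
    rewrite /U; apply: measurable_fun_ifT => //.
    by apply: measurable_funD => //; exact: measurable_cst.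
  have /(measurable_wrtP _ (sF _).1) mXk := FX k.+1.
  have /(measurable_wrtP _ (sF _).1) mUk : measurable_wrt (F k.+1) (U k.+1).
    by move=> B mB; apply: (nF k); rewrite ?leqnSn//; exact: IH.
  rewrite /U [stopped_sum _ _ k.+2]/=; apply: measurable_fun_ifT => //.
    apply: measurable_fun_ltr => //; exact: measurableT_comp.
  by apply: measurable_funD.
have mUT k : measurable_fun setT (U k).
  case: k => [|k]; first exact: measurable_cst.
  exact: measurable_wrt_measurable (mU k).
have ih k : mu.-integrable setT (EFin \o U k) ->
    mu.-integrable setT (EFin \o (fun w => huber l (U k w))).
  move=> iU; apply: (integrable_le_norm _ _ (integrable_scale (2 * l) iU)).
    exact: (measurableT_comp measurable_huber (mUT k)).
  move=> w; rewrite ger0_norm ?huber_ge0 ?(ltW l_gt0)// normrM (@ger0_norm _ (2 * l)).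
    by rewrite huber_le_norm// ltW.
  by rewrite mulr_ge0// ltW.
have ic k : mu.-integrable setT (EFin \o (fun w => clipped_sqr l (X k w))).
  apply: (integrable_le_norm _ _ (integrable_scale (4 * l) (iX k))).
    exact: (measurableT_comp measurable_clipped_sqr (mXT k)).
  move=> w; rewrite ger0_norm ?clipped_sqr_ge0// normrM (@ger0_norm _ (4 * l)).
    by rewrite ge_min lexx orbT.
  by rewrite mulr_ge0// ltW.
(* The linear term has no sign, so the induction runs on real-valued integrals and carries
   integrability along. *)
suff [iUn Un_le] : mu.-integrable setT (EFin \o U n) /\
    \int[mu]_w huber l (U n w) <=
      \sum_(0 <= k < n) \int[mu]_w clipped_sqr l (X k w).
  split=> //; rewrite -[leLHS]fineK; last exact: integrable_fin_num (ih _ iUn).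
  apply: (@le_trans _ _ (\sum_(0 <= k < n) \int[mu]_w clipped_sqr l (X k w))%:E).
    by rewrite lee_fin.
  rewrite -sumEFin; apply: lee_sum => k _.
  by rewrite fineK//; exact: integrable_fin_num (ic k).
elim: n => [|n [iU IH]].
  split.
    apply: (integrable_le_norm (g := X 0%N)) => //.
    by move=> w; rewrite /U/= normr0.
  rewrite big_nil (_ : (fun w => _) = cst 0); first by rewrite Rintegral_cst// mul0r.
  by apply/funext => w; rewrite /U/huber/= normr0 (ltW l_gt0) expr0n.
have iU1 : mu.-integrable setT (EFin \o U n.+1).
  apply: (integrable_le_norm (g := fun w => `|U n w| + `|X n w|)) => //.
    move=> w; rewrite (ger0_norm (addr_ge0 _ _))// /U/=.
    by case: ifP => _; [exact: ler_normD|rewrite lerDl].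
  by apply: integrable_add; exact: integrable_norm.
split=> //.
pose Z w := if `|U n w| < l then 2 * U n w else 0.
have Zl w : `|Z w| <= 2 * l.
  rewrite /Z; case: ifPn => [/ltW ?|_]; last by rewrite normr0 mulr_ge0// ltW.
  by rewrite normrM ger0_norm// ler_pM2l.
have mh : measurable_fun setT (fun u : R => if `|u| < l then 2 * u else 0).
  apply: measurable_fun_ifT; last exact: measurable_cst.
    by apply: measurable_fun_ltr => //; exact: measurable_normr.
  by apply: measurable_funM; [exact: measurable_cst|exact: measurable_id].
have mZ : measurable_fun setT Z by exact: (measurableT_comp mh (mUT n)).
have Z0 : \int[mu]_w (Z w * X n w) = 0.
  (* At the first step there is no past to condition on, but [U 0 = 0] makes [Z] vanish. *)
  case: n => [|n] in Z Zl mZ {iU IH iU1} *.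
    rewrite (_ : (fun w => _) = cst 0); first by rewrite Rintegral_cst// mul0r.
    by apply/funext => w; rewrite /Z/U/= mulr0 if_same mul0r.
  apply: (Rintegral_boundedM_eq0 (sF n) (iX n.+1)) Zl.
  - move=> A FA; rewrite /Rintegral; have [_ _ <-//] := X0 n.
    by rewrite integral0.
  - exact: (measurable_wrt_comp mh (mU n)).
have iZX := integrable_boundedM mZ Zl (iX n).
rewrite big_nat_recr//=; apply: le_trans (lerD IH (lexx _)).
(* The zero integral is added so that the inequality can be checked pointwise. *)
rewrite -[leRHS](addr0) -Z0 addrAC -RintegralD//; last exact: ih.
rewrite -RintegralD//; last by apply: integrable_add => //; exact: ih.
apply: le_Rintegral => //.
- exact: ih.
- by apply: integrable_add => //; apply: integrable_add => //; exact: ih.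
move=> w _; rewrite /Z (_ : U n.+1 w = if `|U n w| < l then U n w + X n w else U n w)//.
case: ifPn => ul; first exact: huberD_le.
by rewrite mul0r addr0 lerDl clipped_sqr_ge0.
Qed.

(** Markov's inequality for [huber l (U n)], which is at least [l ^ 2] once the partial sums have
    reached level [l]. *)
Lemma martingale_maximal_le n :
  ((l ^+ 2)%:E * mu [set w | (l <= \big[Num.max/0]_(1 <= k < n.+1)
                                     `|\sum_(0 <= j < k) X j w|)%R]
   <= \sum_(0 <= k < n) \int[mu]_w (clipped_sqr l (X k w))%:E)%E.
Proof.
have [mU U_le] := huber_stopped_sum_le n; apply: le_trans U_le.
have mX k : measurable_fun setT (X k).
  by have [F [_ iX _ _]] := X_mds; apply/measurable_EFinP; case/integrableP: (iX k).
have mhU : measurable_fun setT (fun w => huber l (U n w)).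
  exact: (measurableT_comp measurable_huber mU).
have l0 := ltW l_gt0.
apply: le_trans (markov_ge0 mu mhU (fun w => huber_ge0 _ l0) (exprn_gt0 2 l_gt0)).
apply: lee_wpmul2l; first by rewrite lee_fin sqr_ge0.
apply: le_measure.
- rewrite inE -[X in measurable X]setTI; apply: measurable_fun_ler => //.
  apply: measurable_bigmax => k; apply: measurableT_comp => //.
  exact: measurable_sum.
- rewrite inE -[X in measurable X]setTI; exact: measurable_fun_ler.
move=> w /= lmax; apply: huber_ge_sqr => //; rewrite leNgt; apply/negP => Ul.
have [_ sum_lt] := stopped_sum_lt Ul.
have [k kn] := bigmax_nat_ge l_gt0 lmax.
by rewrite leNgt sum_lt.
Qed.

End martingale_maximal.

Lemma stationary_martingale_maximal_le d (T : measurableType d) (R : realType)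
    (mu : probability T R) (phi : T -> T) (m : T -> R) (l : R) (n : nat) :
  measurable_fun setT phi ->
  (forall A, measurable A -> mu (phi @^-1` A) = mu A) ->
  measurable_fun setT m ->
  martingale_differences mu (fun i w => m (iter i phi w)) -> 0 < l ->
  ((l ^+ 2)%:E * mu [set w | (l <= max_birkhoff_sum phi m n w)%R]
   <= n%:R%:E * \int[mu]_w (clipped_sqr l (m w))%:E)%E.
Proof.
move=> mphi phi_mu mm mds l0; apply: (le_trans (martingale_maximal_le mds l0 n)).
rewrite (eq_bigr (fun=> \int[mu]_w (clipped_sqr l (m w))%:E)%E) => [|k _].
  by rewrite mule_natl [leLHS]sumr_const_nat subn0.
have mc : measurable_fun setT (fun w => clipped_sqr l (m w)).
  exact: (measurableT_comp (measurable_clipped_sqr l) mm).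
apply: (ge0_integral_comp_iter mphi phi_mu k mc) => w.
exact: clipped_sqr_ge0.
Qed.

(** * Maximal inequality for coboundaries *)

Section coboundary.
Context d (T : measurableType d) (R : realType) (mu : probability T R).
Variables (phi : T -> T) (g : T -> R).
Hypotheses (mphi : measurable_fun setT phi)
  (phi_mu : forall A, measurable A -> mu (phi @^-1` A) = mu A)
  (mg : measurable_fun setT g).

Let h w := g w - g (phi w).

Let mh : measurable_fun setT h.
Proof. by apply: measurable_funB => //; exact: (measurableT_comp mg mphi). Qed.

Let sum_coboundary n w : \sum_(0 <= i < n) h (iter i phi w) = g w - g (iter n phi w).
Proof.
elim: n => [|n IH]; first by rewrite big_nil subrr.
by rewrite big_nat_recr//= IH /h addrA subrK.
Qed.

Let excess c w := Num.max 0 (`|h w| - c).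

Let mexcess c : measurable_fun setT (excess c).
Proof.
apply: measurable_maxr; first exact: measurable_cst.
by apply: measurable_funB => //; exact: measurableT_comp.
Qed.

Let excess_ge0 c w : 0 <= excess c w.
Proof. by rewrite le_max lexx. Qed.

(** Lowering each of the [l] terms by [x / (2 l)] removes [x / 2] in all, so the excesses still sum
    to [x / 2]. Applying Markov to them rather than to [|h|] keeps the decay needed for summation
    over [n]. *)
Lemma sum_norm_coboundary_tail (x : R) (l : nat) : 0 < x -> (0 < l)%N ->
  (mu [set w | (x <= \sum_(0 <= i < l) `|h (iter i phi w)|)%R]
   <= (2 * l%:R / x)%:E * \int[mu]_w (excess (x / (2 * l%:R)) w)%:E)%E.
Proof.
move=> x0 l0; set c := x / (2 * l%:R).
have l0' : 0 < l%:R :> R by rewrite ltr0n.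
pose E w := \sum_(0 <= i < l) excess c (iter i phi w).
have mE : measurable_fun setT E.
  by apply: measurable_sum => i; exact: (measurable_comp_iter mphi).
have E0 w : 0 <= E w by apply: sumr_ge0 => i _.
have mI i : measurable_fun setT (fun w => `|h (iter i phi w)|).
  by apply: measurableT_comp => //; exact: (measurable_comp_iter mphi).
apply: (@le_trans _ _ (mu [set w | x / 2 <= E w])).
  apply: le_measure.
  - rewrite inE -[X in measurable X]setTI; apply: measurable_fun_ler => //.
    exact: measurable_sum.
  - by rewrite inE -[X in measurable X]setTI; exact: measurable_fun_ler.
  move=> w /= xh.
  have : \sum_(0 <= i < l) `|h (iter i phi w)| <= \sum_(0 <= i < l) (excess c (iter i phi w) + c).
    by apply: ler_sum => i _; rewrite -lerBlDr le_max lexx orbT.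
  rewrite big_split/= sumr_const_nat subn0 -/(E w) => hE.
  have cE : c *+ l = x / 2 by rewrite -mulr_natr /c; field; rewrite gt_eqF.
  by move: hE; rewrite cE; lra.
have x2 : 0 < x / 2 by rewrite divr_gt0.
have -> : (2 * l%:R / x)%:E = ((x / 2)^-1 * l%:R)%:E :> \bar R.
  by congr _%:E; field; rewrite gt_eqF.
rewrite EFinM -muleA lee_pdivlMl//.
apply: le_trans (markov_ge0 mu mE E0 x2) _.
under eq_integral do rewrite /E -sumEFin.
rewrite ge0_integral_sum//; last 2 first.
- by move=> i; apply/measurable_EFinP; exact: (measurable_comp_iter mphi).
- by move=> i w _; rewrite lee_fin.
rewrite (eq_bigr (fun=> \int[mu]_w (excess c w)%:E)%E) => [|i _].
  by rewrite mule_natl [leLHS]sumr_const_nat subn0.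
by apply: (ge0_integral_comp_iter mphi phi_mu i (mexcess c)) => w.
Qed.

(* If |g| is large somewhere along the orbit up to time n, then at the preceding
   multiple of l either |g| is already large or h varies a lot over l steps. *)
Lemma coboundary_maximal_le (x : R) (l n : nat) : 0 < x -> (0 < l)%N ->
  (mu [set w | (4 * x <= \big[Num.max/0]_(1 <= k < n.+1) `|g w - g (iter k phi w)|)%R]
   <= (n %/ l).+1%:R%:E *
      (mu [set w | (x <= `|g w|)%R] +
       (2 * l%:R / x)%:E * \int[mu]_w (excess (x / (2 * l%:R)) w)%:E))%E.
Proof.
move=> x0 l0.
pose A := [set w | x <= `|g w|].
pose B := [set w | x <= \sum_(0 <= i < l) `|h (iter i phi w)|].
have mA : measurable A.
  rewrite -[X in measurable X]setTI; apply: measurable_fun_ler => //.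
  exact: measurableT_comp.
have mB : measurable B.
  rewrite -[X in measurable X]setTI; apply: measurable_fun_ler => //.
  apply: measurable_sum => i; apply: measurableT_comp => //.
  exact: (measurable_comp_iter mphi).
have mAB : measurable (A `|` B) by exact: measurableU.
pose C j := iter (j * l) phi @^-1` (A `|` B).
have mC j : measurable (C j).
  by rewrite -[X in measurable X]setTI; exact: (measurable_iter mphi).
apply: (@le_trans _ _ (mu (\big[setU/set0]_(j < (n %/ l).+1) C j))).
  apply: le_measure.
  - rewrite inE -[X in measurable X]setTI; apply: measurable_fun_ler => //.
    apply: measurable_bigmax => k; apply: measurableT_comp => //.
    by apply: measurable_funB => //; exact: (measurable_comp_iter mphi).
  - by rewrite inE; apply: bigsetU_measurable.
  move=> w /= /bigmax_nat_ge[|k kn gk]; first by rewrite mulr_gt0.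
  (* One of the two values in the difference is at least half of [4 * x]; the index 0 stands for
     [g w] itself. *)
  have [k' k'n gk'] : exists2 k', (k' <= n)%N & 2 * x <= `|g (iter k' phi w)|.
    have [g0|g0] := leP (2 * x) `|g w|; first by exists 0%N.
    exists k => //; have := ler_normB (g w) (g (iter k phi w)); lra.
  (* The block containing [k'] is chosen. If [|g| < x] at its start, the change up to [k'] exceeds
     [x], and nonnegativity extends the sum of [|h|] to the full block. *)
  rewrite -bigcup_mkord; exists (k' %/ l)%N => /=.
    by rewrite ltnS leq_div2r.
  rewrite /C/=; set v := iter _ phi w.
  have vE : iter k' phi w = iter (k' %% l) phi v.
    by rewrite /v -iterD addnC -divn_eq.
  have [gv|gv] := leP x `|g v|; [by left|right].
  have := sum_coboundary (k' %% l) v; rewrite -vE => hE.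
  have : `|\sum_(0 <= i < k' %% l) h (iter i phi v)| <= \sum_(0 <= i < l) `|h (iter i phi v)|.
    apply: (le_trans (ler_norm_sum _ _ _)).
    rewrite [leRHS](@big_cat_nat _ _ _ (k' %% l))//=; last by rewrite ltnW// ltn_mod.
    by rewrite lerDl sumr_ge0.
  rewrite hE /B/=; have := lerB_dist (g (iter k' phi w)) (g v).
  rewrite distrC; lra.
apply: (le_trans (@Boole_inequality _ _ _ mu C _ _)) => //.
rewrite (eq_bigr (fun=> mu (A `|` B))) => [|j _]; last first.
  exact: (measure_preimage_iter mphi phi_mu).
rewrite [leLHS](_ : _ = (n %/ l).+1%:R%:E * mu (A `|` B))%E; last first.
  by rewrite mule_natl [LHS]sumr_const card_ord.
apply: lee_wpmul2l => //.
apply: (le_trans (measureU2 _ mA mB)).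
by rewrite leeD2l// sum_norm_coboundary_tail.
Qed.

End coboundary.

(** * Convergence of the series *)

Lemma integral_cst_mul d (T : measurableType d) (R : realType)
    (mu : {measure set T -> \bar R}) (c : R) (f : T -> R) :
  measurable_fun setT f -> (forall w, 0 <= f w) -> 0 <= c ->
  (\int[mu]_w (c * f w)%:E = c%:E * \int[mu]_w (f w)%:E)%E.
Proof.
move=> mf f0 c0; under eq_integral do rewrite EFinM.
rewrite ge0_integralZl//; first exact/measurable_EFinP.
by move=> w _; rewrite lee_fin.
Qed.

Section series.
Context d (T : measurableType d) (R : realType) (mu : probability T R).
Variables (phi : T -> T).
Hypotheses (mphi : measurable_fun setT phi)
  (phi_mu : forall A, measurable A -> mu (phi @^-1` A) = mu A).

(** At level [e * n ^ a] the maximal inequality contributes [n ^ (1 - 2 a)], which turns the weight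
    into that of [sum_min_sqr_le], applied with [K = 4 * e] and [y = |m|]. *)
Lemma martingale_series_lty (m : T -> R) (a p e : R) :
  0 < a <= 1 -> 1 < p < 2 -> 0 < e -> m \in Lfun mu p%:E ->
  martingale_differences mu (fun i w => m (iter i phi w)) ->
  (\sum_(1 <= n <oo) (n%:R `^ (a * p - 2))%:E *
     mu [set w | (e * n%:R `^ a <= max_birkhoff_sum phi m n w)%R] < +oo)%E.
Proof.
move=> ha hp e0 mLp mds; have p0 : 0 < p by lra.
have [mm im] := Lfun_powR_integrable p0 mLp.
pose C := 4 * e / (a * (p - 1)) + (1 + (a * (2 - p))^-1).
pose F n w := e ^- 2 * (n%:R `^ (a * p - 1 - 2 * a) *
  Num.min (`|m w| ^+ 2) (4 * e * n%:R `^ a * `|m w|)).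
have mnm : measurable_fun setT (fun w => `|m w|) by exact: measurableT_comp.
have mmin n : measurable_fun setT
    (fun w => Num.min (`|m w| ^+ 2) (4 * e * n%:R `^ a * `|m w|)).
  apply: measurable_minr; first exact: measurable_funX.
  exact: measurable_funM.
have min0 n w : 0 <= Num.min (`|m w| ^+ 2) (4 * e * n%:R `^ a * `|m w|).
  by rewrite le_min sqr_ge0 !mulr_ge0 ?powR_ge0 ?(ltW e0).
have e2 : 0 <= e ^- 2 by rewrite invr_ge0 sqr_ge0.
apply: (@nneseries_lty_dominated _ _ _ mu _ F (fun w => e ^- 2 * (C * `|m w| `^ p))).
- by move=> n; rewrite mule_ge0// lee_fin powR_ge0.
- by move=> n; do 2 (apply: measurable_funM => //).
- by move=> n w; rewrite /F mulr_ge0// mulr_ge0// powR_ge0.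
- move=> n n0; have n0' : 0 < n%:R :> R by rewrite ltr0n.
  have na0 : 0 < n%:R `^ a :> R by exact: powR_gt0.
  have l0 : 0 < e * n%:R `^ a by exact: mulr_gt0.
  have := stationary_martingale_maximal_le n mphi phi_mu mm mds l0.
  have -> : (\int[mu]_w (clipped_sqr (e * n%:R `^ a) (m w))%:E =
      \int[mu]_w (Num.min (`|m w| ^+ 2) (4 * e * n%:R `^ a * `|m w|))%:E)%E.
    by apply: eq_integral => w _; rewrite /clipped_sqr real_normK ?num_real// mulrA.
  rewrite /F; under [X in _ -> (_ <= X)%E]eq_integral do rewrite mulrA.
  rewrite integral_cst_mul//; last by rewrite mulr_ge0 ?powR_ge0.
  rewrite -lee_pdivlMl ?exprn_gt0// => h.
  have -> : (e ^- 2 * n%:R `^ (a * p - 1 - 2 * a))%:E =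
      ((n%:R `^ (a * p - 2))%:E * (((e * n%:R `^ a) ^+ 2)^-1%:E * n%:R%:E))%E :> \bar R.
    rewrite -!EFinM; congr _%:E.
    have -> : a * p - 1 - 2 * a = (a * p - 2) + (1 - a * 2) by ring.
    rewrite powRD ?(gt_eqF n0') ?implybT// (@powRB _ _ 1) ?(gt_eqF n0') ?implybT//.
    rewrite powRr1 ?(ltW n0')// powRrM powR_mulrn ?(ltW na0)//.
    by field; rewrite !gt_eqF.
  rewrite -!muleA; apply: lee_wpmul2l; first by rewrite lee_fin powR_ge0.
  by [].
- by apply: integrable_scale; exact: integrable_scale.
- move=> M w; rewrite /F -mulr_sumr ler_wpM2l//.
  by apply: sum_min_sqr_le => //; rewrite mulr_ge0 ?(ltW e0).
Qed.

(** With [x = e * n ^ a] and [l] of order [n ^ b], each term splits into a weight [n ^ (a q - 1)] on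
    [x <= |g|] and a weight [n ^ (s - 1)] on the excess of [|h|] over a level of order [n ^ y]. *)
Lemma coboundary_series_lty (g : T -> R) (a p q r e : R) :
  0 < a <= 1 -> 1 <= q -> q < p -> p < r -> p < 2 -> 0 < e ->
  (p - 1) * r / (r - 1) <= q ->
  g \in Lfun mu q%:E -> (fun w => g w - g (phi w)) \in Lfun mu r%:E ->
  (\sum_(1 <= n <oo) (n%:R `^ (a * p - 2))%:E *
     mu [set w | (4 * e * n%:R `^ a <=
       \big[Num.max/0]_(1 <= k < n.+1) `|g w - g (iter k phi w)|)%R] < +oo)%E.
Proof.
move=> /[dup] ha /andP[a0 a1] q1 qp pr p2 e0 hq gLq hLr.
have q0 : 0 < q by lra.
have r0 : 0 < r by lra.
have [mg ig] := Lfun_powR_integrable q0 gLq.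
have [mh ih] := Lfun_powR_integrable r0 hLr.
set h := fun w => g w - g (phi w) in hLr mh ih.
(* Here [y = a - b] is the exponent of [x / l], and [c = e / 4] comes from [l <= 2 * n ^ b], which
   gives [x / (2 l) >= c * n ^ y]. *)
pose b := a * (p - q); pose c := e / 4; pose s := a * (p - 1).
pose y := a * (1 - p + q).
have c0 : 0 < c by rewrite divr_gt0.
have y0 : 0 < y by rewrite mulr_gt0//; lra.
have hs : 0 < s <= 1 by rewrite mulr_gt0 ?mulr_ile1//; lra.
have b0 : 0 <= b by rewrite mulr_ge0//; lra.
have b1 : b <= 1 by rewrite mulr_ile1//; lra.
(* The assumed lower bound on [q] enters here: after clearing denominators it reads
   [p - 1 <= (r - 1) (1 - p + q)]. *)
have sy : s / y <= r - 1.
  rewrite ler_pdivrMr// /s /y mulrCA ler_pM2l//.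
  by move: hq; rewrite ler_pdivrMr; [lra|lra].
pose excess c w := Num.max 0 (`|h w| - c).
have mexcess c' : measurable_fun setT (excess c').
  apply: measurable_maxr; first exact: measurable_cst.
  by apply: measurable_funB => //; exact: measurableT_comp.
have excess0 c' w : 0 <= excess c' w by rewrite le_max lexx.
pose A n := [set w | e * n%:R `^ a <= `|g w|].
have mA n : measurable (A n).
  rewrite -[X in measurable X]setTI; apply: measurable_fun_ler => //.
  exact: measurableT_comp.
(* The factor 2 bounds the number of blocks by [2 * n ^ (1 - b)]; [8 / e] is this 2 times the 4 in
   [2 * l / x <= 4 * n ^ b / x], divided by the [e] in [x]. *)
pose F1 n w : R := 2 * n%:R `^ (a * q - 1) * \1_(A n) w.
pose F2 n w := 8 / e * n%:R `^ (s - 1) * excess (c * n%:R `^ y) w.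
have F10 n w : 0 <= F1 n w by rewrite /F1 !mulr_ge0 ?powR_ge0.
have F20 n w : 0 <= F2 n w by rewrite /F2 !mulr_ge0 ?powR_ge0 ?invr_ge0 ?(ltW e0).
have mF1 n : measurable_fun setT (F1 n).
  by apply: measurable_funM => //; exact: measurable_indic.
have mF2 n : measurable_fun setT (F2 n) by exact: measurable_funM.
apply: (@nneseries_lty_dominated _ _ _ mu _ (fun n w => F1 n w + F2 n w)
  (fun w => 2 * ((`|g w| / e) `^ q / a) + 2 * ((1 + (`|h w| / c) `^ r) / s))).
- by move=> n; rewrite mule_ge0// lee_fin powR_ge0.
- by move=> n; exact: measurable_funD.
- by move=> n w; rewrite addr_ge0.
- move=> n n0; have n1 : 1 <= n%:R :> R by rewrite ler1n.
  have n0' : 0 < n%:R :> R by rewrite ltr0n.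
  have powD u v : n%:R `^ (u + v) = n%:R `^ u * n%:R `^ v :> R.
    by rewrite powRD// (gt_eqF n0') implybT.
  have pow0 u : 0 < n%:R `^ u :> R by exact: powR_gt0.
  pose x := e * n%:R `^ a; have x0 : 0 < x by exact: mulr_gt0.
  pose l := (Num.truncn (n%:R `^ b : R)).+1.
  have l0 : 0 < l%:R :> R by rewrite ltr0n.
  have l_gt : n%:R `^ b < l%:R :> R by exact: truncnS_gt.
  have l_le : l%:R <= 2 * n%:R `^ b :> R.
    have h1 : (Num.truncn (n%:R `^ b : R))%:R <= n%:R `^ b :> R.
      by rewrite truncn_le ltW.
    have h2 : 1 <= n%:R `^ b :> R by rewrite -[leLHS](powRr0 n%:R) ler_powR.
    by rewrite [l%:R](_ : _ = (Num.truncn (n%:R `^ b : R))%:R + 1) ?natr1//; lra.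
  have nl : (n %/ l).+1%:R <= 2 * n%:R `^ (1 - b) :> R.
    have h1 : 1 <= n%:R `^ (1 - b) :> R.
      by rewrite -[leLHS](powRr0 n%:R) ler_powR// subr_ge0.
    have h2 : (n %/ l)%:R <= n%:R `^ (1 - b) :> R.
      apply: (@le_trans _ _ (n%:R / l%:R)).
        by rewrite ler_pdivlMr// -natrM ler_nat leq_divM.
      rewrite powRB ?(gt_eqF n0') ?implybT// powRr1 ?(ltW n0')//.
      by rewrite ler_pM2l// lef_pV2 ?posrE// ltW.
    by rewrite -[(n %/ l).+1%:R]natr1; lra.
  have lx0 : 0 <= 2 * l%:R / x.
    by apply: divr_ge0; [apply: mulr_ge0 => //; exact: ltW|exact: ltW].
  have nx0 : 0 <= 4 * n%:R `^ b / x.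
    by apply: divr_ge0; [apply: mulr_ge0 => //; exact: powR_ge0|exact: ltW].
  have lx : 2 * l%:R / x <= 4 * n%:R `^ b / x.
    by rewrite ler_pM2r ?invr_gt0//; lra.
  have cx : c * n%:R `^ y <= x / (2 * l%:R).
    rewrite ler_pdivlMr ?mulr_gt0// /c /x.
    have -> : a = y + b :> R by rewrite /y /b; ring.
    rewrite powD.
    have -> : e / 4 * n%:R `^ y * (2 * l%:R) = e * n%:R `^ y * (l%:R / 2) by field.
    rewrite mulrA ler_pM2l ?mulr_gt0//; lra.
  have -> : 4 * e * n%:R `^ a = 4 * x by rewrite mulrA.
  have I0 c' : (0 <= \int[mu]_w (excess c' w)%:E)%E.
    by apply: integral_ge0 => w _; rewrite lee_fin.
  apply: (@le_trans _ _ ((n%:R `^ (a * p - 2))%:E * ((2 * n%:R `^ (1 - b))%:E *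
      (mu (A n) + (4 * n%:R `^ b / x)%:E *
         \int[mu]_w (excess (c * n%:R `^ y) w)%:E)))%E).
    apply: lee_wpmul2l; first by rewrite lee_fin powR_ge0.
    apply: (le_trans (coboundary_maximal_le (l := l) mphi phi_mu mg n x0 (ltn0Sn _))).
    apply: lee_pmul => //; rewrite ?lee_fin//.
      by rewrite adde_ge0// mule_ge0//; exact: I0.
    rewrite leeD2l//; apply: lee_pmul => //; first exact: I0.
    apply: ge0_le_integral => //.
    + by move=> w _; rewrite lee_fin; exact: excess0.
    + by apply/measurable_EFinP; exact: mexcess.
    + by apply/measurable_EFinP; exact: mexcess.
    move=> w _; rewrite lee_fin ge_max /excess !le_max lexx/=.
    by rewrite lerD2l lerN2 cx orbT.
  under eq_integral do rewrite EFinD.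
  rewrite ge0_integralD//; last 4 first.
  + by move=> w _; rewrite lee_fin.
  + exact/measurable_EFinP.
  + by move=> w _; rewrite lee_fin.
  + exact/measurable_EFinP.
  have k1 : 0 <= 2 * n%:R `^ (a * q - 1) :> R by rewrite mulr_ge0 ?powR_ge0.
  have k2 : 0 <= 8 / e * n%:R `^ (s - 1).
    by rewrite mulr_ge0 ?powR_ge0// divr_ge0// ltW.
  have mI : measurable_fun setT (\1_(A n) : T -> R) by exact: measurable_indic.
  rewrite (integral_cst_mul mu mI _ k1)//.
  rewrite (integral_cst_mul mu (mexcess _) (excess0 _) k2).
  rewrite integral_indic// setIT muleA ge0_muleDr//; last first.
    by rewrite mule_ge0.
  rewrite !muleA -!EFinM le_eqVlt; apply/orP; left; apply/eqP.
  congr (_%:E * _ + _%:E * _)%E.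
  + have -> : a * q - 1 = (a * p - 2) + (1 - b) by rewrite /b; ring.
    by rewrite (powD (a * p - 2)); ring.
  + have hpow : n%:R `^ (s - 1) * n%:R `^ a =
        n%:R `^ (a * p - 2) * n%:R `^ (1 - b) * n%:R `^ b :> R.
      by rewrite -!powD; congr (_ `^ _); rewrite /s; ring.
    rewrite /x; apply: (@mulIf _ (e * n%:R `^ a)); first by rewrite gt_eqF.
    rewrite [RHS](_ : _ = 8 * (n%:R `^ (s - 1) * n%:R `^ a)).
      by rewrite hpow; field; rewrite !gt_eqF.
    by field; rewrite gt_eqF.
- have powdiv f c' u : 0 < c' -> mu.-integrable setT (EFin \o (fun w => `|f w| `^ u)) ->
      mu.-integrable setT (EFin \o (fun w => (`|f w : R| / c') `^ u)).
    move=> c'0 ifu; rewrite (_ : (fun w => _) = (fun w => c'^-1 `^ u * `|f w| `^ u)).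
      exact: integrable_scale.
    by apply/funext => w; rewrite mulrC powRM// invr_ge0 ltW.
  have iF1 := powdiv _ _ _ e0 ig.
  have iF2 := powdiv _ _ _ c0 ih.
  apply: integrable_add; apply: integrable_scale.
    under [X in _ \o X]eq_fun do rewrite mulrC; exact: integrable_scale.
  under [X in _ \o X]eq_fun do rewrite mulrC; apply: integrable_scale.
  apply: integrable_add => //; exact: finite_measure_integrable_cst.
- move=> M w; rewrite big_split/=; apply: lerD.
    under eq_bigr do rewrite /F1 -mulrA; rewrite -mulr_sumr ler_pM2l//.
    apply: le_trans (sum_powR_level_le M ha q1 _); last first.
      by rewrite divr_ge0 ?(ltW e0).
    rewrite [leRHS]big_mkcond/=; apply: ler_sum => n _.
    rewrite ler_pdivlMr// (mulrC _ e) indicE.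
    case: ifPn => [h1|h1]; first by rewrite ler_piMr ?powR_ge0// lern1 leq_b1.
    by rewrite memNset ?mulr0//=; exact/negP.
  rewrite /F2; under eq_bigr do rewrite -mulrA; rewrite -mulr_sumr.
  have z0 : 0 <= `|h w| / c by rewrite divr_ge0 ?(ltW c0).
  have /(ler_wpM2l (ler0n R 2)) := sum_excess_le M hs y0 sy z0.
  apply: le_trans; rewrite le_eqVlt; apply/orP; left; apply/eqP.
  rewrite !mulr_sumr; apply: eq_bigr => n _; rewrite /excess.
  (* Scaling by [c] reduces to [z = |h| / c], and [8 / e * c = 2]. *)
  have -> : `|h w| - c * n%:R `^ y = c * (`|h w| / c - n%:R `^ y).
    by field; rewrite gt_eqF.
  rewrite -[X in Num.max X _](mulr0 c) -maxr_pMr ?(ltW c0)//.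
  by rewrite {1}/c; field; rewrite gt_eqF.
Qed.

End series.

(** * Combination of the two series *)

Unset Implicit Arguments.
Set Strict Implicit.

Theorem theorem2p7 (d : measure_display) (Omega : measurableType d)
    (R : realType) (mu : probability Omega R) (T : Omega -> Omega)
    (T_aut : automorphism mu T) (T_erg : ergodic mu T)
    (p q r : R) (q_ge1 : 1 <= q) (q_lt_p : q < p) (p_lt_r : p < r) (r_lt2 : r < 2)
    (g : Omega -> R)
    (g_Lq : g \in Lfun mu q%:E)
    (cob_Lr : (fun w => g w - g (T w)) \in Lfun mu r%:E)
    (q_ge : (p - 1) * r / (r - 1) <= q)
    (m : Omega -> R)
    (m_mds : martingale_differences mu (fun i w => m (iter i T w)))
    (m_Lp : m \in Lfun mu p%:E)
    (alpha : R) (alpha_ge : 1 / p <= alpha) (alpha_le : alpha <= 1)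
    (eps : R) (eps_gt0 : 0 < eps) :
  let f : Omega -> R := fun w => m w + g w - g (T w) in
  (\sum_(1 <= n <oo)
     (n%:R `^ (alpha * p - 2))%:E *
     mu [set w | (eps * n%:R `^ alpha <= max_birkhoff_sum T f n w)%R]
   < +oo)%E.
Proof.
cbv zeta; set f := fun w : Omega => m w + g w - g (T w).
have [_ mT _ T_mu] := T_aut.
have p1 : 1 < p by lra.
have p0 : 0 < p by lra.
have a0 : 0 < alpha by apply: lt_le_trans alpha_ge; rewrite divr_gt0.
have ha : 0 < alpha <= 1 by rewrite a0.
have e2 : 0 < eps / 2 by lra.
(* The coboundary series is stated at level [4 * e], so [e = eps / 8] yields level [eps / 2]. *)
have e8 : 0 < eps / 8 by lra.
have hp : 1 < p < 2 by rewrite p1; lra.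
have M_lty := martingale_series_lty mT T_mu ha hp e2 m_Lp m_mds.
have C_lty := coboundary_series_lty mT T_mu ha q_ge1 q_lt_p p_lt_r
  (lt_trans p_lt_r r_lt2) e8 q_ge g_Lq cob_Lr.
have q0 : 0 < q by lra.
have [mm _] := Lfun_powR_integrable p0 m_Lp.
have [mg _] := Lfun_powR_integrable q0 g_Lq.
have mX k : measurable_fun setT (fun w => `|birkhoff_sum T m k w|).
  apply: measurableT_comp => //; apply: measurable_sum => i.
  exact: (measurable_comp_iter mT).
have mY k : measurable_fun setT (fun w => `|g w - g (iter k T w)|).
  apply: measurableT_comp => //; apply: measurable_funB => //.
  exact: (measurable_comp_iter mT).
have mf : measurable_fun setT f.
  apply: measurable_funB; first exact: measurable_funD.
  exact: (measurableT_comp mg mT).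
have mZ k : measurable_fun setT (fun w => `|birkhoff_sum T f k w|).
  apply: measurableT_comp => //; apply: measurable_sum => i.
  exact: (measurable_comp_iter mT).
have meas_ge (F : nat -> Omega -> R) (n : nat) (c : R) :
    (forall k, measurable_fun setT (F k)) ->
    measurable [set w | c <= \big[Num.max/0]_(1 <= k < n.+1) F k w].
  move=> mF; rewrite -[X in measurable X]setTI; apply: measurable_fun_ler => //.
  exact: measurable_bigmax.
have S_f n w : birkhoff_sum T f n w = birkhoff_sum T m n w + (g w - g (iter n T w)).
  elim: n => [|n IH]; first by rewrite /birkhoff_sum !big_nil subrr addr0.
  rewrite /birkhoff_sum !big_nat_recr//= in IH *.
  by rewrite IH /f; ring.
apply: le_lt_trans (lte_add_pinfty M_lty C_lty).
rewrite -nneseriesD; last 2 first.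
- by move=> n _ _; rewrite mule_ge0// lee_fin powR_ge0.
- by move=> n _ _; rewrite mule_ge0// lee_fin powR_ge0.
apply: lee_nneseries => n _; first by rewrite mule_ge0// lee_fin powR_ge0.
rewrite -ge0_muleDr//; apply: lee_wpmul2l.
  by rewrite lee_fin powR_ge0.
apply: le_trans (measureU2 _ _ _); [|exact: meas_ge..].
apply: le_measure; rewrite ?inE.
- exact: meas_ge.
- by apply: measurableU; exact: meas_ge.
move=> w /= h; apply: contrapT => /not_orP[/negP]; rewrite -ltNge => h1.
move=> /negP; rewrite -ltNge => h2.
(* At [n = 0] the empty maximum and the level are both 0, which contradicts the strict inequality
   [h1]. *)
have [n0|n0] := posnP n.
  by move: h1; rewrite n0 powR0 ?gt_eqF// mulr0 /max_birkhoff_sum big_geq// ltxx.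
have en0 : 0 < eps * n%:R `^ alpha by rewrite mulr_gt0// powR_gt0// ltr0n.
have [k kn] := bigmax_nat_ge en0 h.
rewrite S_f => hk; have := ler_normD (birkhoff_sum T m k w) (g w - g (iter k T w)).
(* The index found may be 0, where both sums vanish below a positive level; otherwise it lies in the
   range of both maxima. *)
have [k0|k0] := posnP k.
  move: hk; rewrite k0 /birkhoff_sum big_nil subrr add0r normr0; lra.
have le_max (F : nat -> R) : F k <= \big[Num.max/0]_(1 <= k < n.+1) F k.
  by apply: le_bigmax_seq => //; rewrite mem_index_iota k0.
have := le_max (fun k => `|birkhoff_sum T m k w|).
have := le_max (fun k => `|g w - g (iter k T w)|).
move: h1 h2; rewrite /max_birkhoff_sum /=; lra.
Qed.
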